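(* For every fixed $d\geq 10$, the random graph $G(n,d/n)$ is almost surely $(16d,16d)$-degenerate.
   Context: $G(n,p)$ is the random graph on $n$ labeled vertices in which each edge appears independently with probability $p$; almost surely means with probability tending to $1$ as $n\to\infty$. A graph $H$ is $(d',\Delta)$-degenerate if there is an ordering $v_1,\ldots,v_n$ of its vertices such that for each $v_i$: (1) at most $d'$ vertices $v_j$ with $j<i$ are adjacent to $v_i$, and (2) there are at most $\Delta$ subsets $S\subset\{v_1,\ldots,v_i\}$ such that $S=N(v_j)\cap\{v_1,\ldots,v_i\}$ for some neighbor $v_j$ of $v_i$ with $j>i$, where $N(v)$ is the set of neighbors of $v$. *)

(* Defs.v *)
From HB Require Import structures.
From mathcomp Require Import all_boot all_order all_algebra.
From mathcomp Require Import all_classical all_reals all_analysis.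

Set Implicit Arguments.
Unset Strict Implicit.
Unset Printing Implicit Defensive.

Import Order.TTheory GRing.Theory Num.Theory.
Import numFieldNormedType.Exports.

Local Open Scope ring_scope.

Definition vertex_pairs (T : finType) : {set {set T}} :=
  [set e : {set T} | #|e| == 2].

(* A simple graph on the vertex set T is given by its set of edges. *)
Definition sgraph (T : finType) : finType :=
  {E : {set {set T}} | E \subset vertex_pairs T}.

Definition edge_set (T : finType) (G : sgraph T) : {set {set T}} := val G.

Definition adj (T : finType) (G : sgraph T) : rel T :=
  fun u v => [set u; v] \in edge_set G.

Definition neighbors (T : finType) (G : sgraph T) (v : T) : {set T} :=
  [set w | adj G v w].

Section Degenerate.
Variables (R : realType) (T : finType) (G : sgraph T).

Definition vertex_ordering (v : {ffun 'I_#|T| -> T}) : bool := injectiveb v.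

Definition initial_segment (v : {ffun 'I_#|T| -> T}) (i : 'I_#|T|) : {set T} :=
  [set v j | j : 'I_#|T| & (j <= i)%N].

Definition back_neighbors (v : {ffun 'I_#|T| -> T}) (i : 'I_#|T|) : {set T} :=
  [set v j | j : 'I_#|T| & (j < i)%N && adj G (v i) (v j)].

Definition forward_traces (v : {ffun 'I_#|T| -> T}) (i : 'I_#|T|) :
    {set {set T}} :=
  [set neighbors G (v j) :&: initial_segment v i
     | j : 'I_#|T| & (i < j)%N && adj G (v i) (v j)].

(* The two bounds are real numbers, since they need not be integers
   when they are multiples of a real average degree. *)
Definition degenerate (d' Delta : R) : bool :=
  [exists v : {ffun 'I_#|T| -> T},
     vertex_ordering v &&
     [forall i : 'I_#|T|,
        (#|back_neighbors v i|%:R <= d') &&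
        (#|forward_traces v i|%:R <= Delta)]].

End Degenerate.

(* Probability that G(n, p) has the property A: the edges being independent,
   a given graph has as its probability a product over all pairs of vertices.
   This is a probability only for 0 <= p <= 1. *)
Definition Gnp_prob (R : realType) (n : nat) (p : R)
    (A : pred (sgraph 'I_n)) : R :=
  \sum_(G : sgraph 'I_n | A G)
    \prod_(e in vertex_pairs 'I_n) (if e \in edge_set G then p else 1 - p).

Definition almost_surely (R : realType) (p : nat -> R)
    (A : forall n : nat, pred (sgraph 'I_n)) : Prop :=
  ((fun n : nat => Gnp_prob (p n) (A n)) @ \oo --> (1 : R))%classic.

(* Main.v *)
Require Import Defs.
From mathcomp Require Import all_boot all_order all_algebra.
From mathcomp Require Import all_classical all_reals all_analysis.
From mathcomp Require Import fintype finset zify ring lra.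

Import Order.TTheory GRing.Theory Num.Theory.
Import numFieldNormedType.Exports.

Set Implicit Arguments.
Unset Strict Implicit.
Unset Printing Implicit Defensive.

Local Open Scope ring_scope.

(* Let D be the integer part of d and a about n / 32 ^ D. By union bounds,
   almost surely no a vertices all have degree at least 16 D, and every set of
   2 j <= 4 a vertices spans fewer than 3 j edges. Given these two properties,
   let H be the set of vertices of degree at least 16 D and close it under
   adding vertices with two neighbours in the current set. By sparsity the
   closure C has fewer than 4 |H| vertices. Order C recursively (with degrees
   taken inside C), then append the other vertices in any order. The latter
   have small degree; each of them has at most one neighbour in C, so for a
   vertex x of C they only contribute the trace {x}. Counting this trace once
   and for all, together with those coming from C, makes the bound on the
   number of traces stable under the recursion. *)

Definition pairs_within (T : finType) (S : {set T}) : {set {set T}} :=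
  [set e in vertex_pairs T | e \subset S].

Definition pairs_meeting (T : finType) (S : {set T}) : {set {set T}} :=
  [set e in vertex_pairs T | e :&: S != set0].

Lemma in_vertex_pairs (T : finType) (e : {set T}) :
  (e \in vertex_pairs T) = (#|e| == 2)%N.
Proof. by rewrite inE. Qed.

(** * Orderings of sets of vertices in a fixed graph *)

Section Orderings.
Local Open Scope nat_scope.
Variables (T : finType) (G : sgraph T).

Lemma edge_set_sub : edge_set G \subset vertex_pairs T.
Proof. exact: (valP G). Qed.

Lemma adjC u v : adj G u v = adj G v u.
Proof. by rewrite /adj setUC. Qed.

Lemma adj_pair u v : adj G u v -> [set u; v] \in vertex_pairs T.
Proof. exact: (subsetP edge_set_sub). Qed.

Lemma inj_pair (v : T) : injective (fun w : T => [set v; w]).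
Proof.
move=> w1 w2 /= eq12.
have: w1 \in [set v; w2] by rewrite -eq12 !inE eqxx orbT.
have: w2 \in [set v; w1] by rewrite eq12 !inE eqxx orbT.
rewrite !inE => /orP[/eqP->|/eqP-> //] /orP[] /eqP-> //.
Qed.

(** An edge is counted at most once from each of its two ends. The set [Z] is left free because both
    the pairs inside a set and the pairs meeting a set are needed. *)
Lemma sum_degree_le (A B : {set T}) (Z : {set {set T}}) :
  (forall v w, v \in A -> w \in B -> adj G v w -> [set v; w] \in Z) ->
  \sum_(v in A) #|neighbors G v :&: B| <= 2 * #|edge_set G :&: Z|.
Proof.
move=> ABZ; pose F := edge_set G :&: Z.
have degE v : v \in A -> #|neighbors G v :&: B| <= \sum_(e in F) (v \in e).
  move=> vA; rewrite -(card_imset _ (@inj_pair v)).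
  rewrite -sum1_card big_mkcond [leqRHS]big_mkcond /=; apply: leq_sum => e _.
  case: imsetP => // -[w]; rewrite !inE => /andP[vw wB] ->.
  by rewrite (ABZ _ _ vA wB vw) andbT [_ \in edge_set _]vw !inE eqxx.
apply: (leq_trans (leq_sum _ degE)).
rewrite exchange_big /= mulnC -sum_nat_const; apply: leq_sum => e.
rewrite inE => /andP[/(subsetP edge_set_sub)];
  rewrite in_vertex_pairs => /eqP <- _.
rewrite -sum1_card big_mkcond [leqRHS]big_mkcond /=; apply: leq_sum => v _.
by case: (v \in A); case: (v \in e).
Qed.

Lemma edges_within_setU1 (C : {set T}) (y : T) : y \notin C ->
  #|edge_set G :&: pairs_within C| + #|neighbors G y :&: C|
    <= #|edge_set G :&: pairs_within (y |: C)|.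
Proof.
move=> yC; rewrite -(card_imset (neighbors G y :&: C) (@inj_pair y)).
rewrite -cardsUI (_ : _ :&: imset _ _ = set0) ?cards0 ?addn0; last first.
  apply/setP => e; rewrite !inE; apply/negP => /andP[/and3P[_ _ eC]].
  case/imsetP => w _ eE; case/negP: yC.
  by apply: (subsetP eC); rewrite eE !inE eqxx.
apply: subset_leq_card; apply/subsetP => e; rewrite !inE.
case/orP=> [/and3P[-> -> eC] /=|/imsetP[w]].
  exact: subset_trans eC (subsetUr _ _).
rewrite !inE => /andP[yw wC] ->; rewrite [_ \in edge_set _]yw /=.
have := adj_pair yw; rewrite inE => -> /=.
by apply/subsetP => z; rewrite !inE => /orP[]/eqP->; rewrite ?eqxx ?wC ?orbT.
Qed.

(* Absorb, one at a time, the vertices having two neighbours in the current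
   set: each contributes two new edges, so reaching size 4 |H| would produce
   a set of 4 |H| vertices spanning 6 |H| edges. *)
Lemma two_neighbour_closure (B H : {set T}) : H \subset B ->
  (0 < #|H| -> forall C : {set T}, #|C| = 4 * #|H| ->
     #|edge_set G :&: pairs_within C| < 6 * #|H|) ->
  exists C : {set T}, [/\ H \subset C, C \subset B, #|C| <= (4 * #|H|).-1 &
    forall y, y \in B :\: C -> #|neighbors G y :&: C| <= 1].
Proof.
move=> HB sparse.
(* The last clause says, without subtraction, that [C] spans at least [2 * (#|C| - #|H|)] edges. A
   set of maximal size with these properties replaces the iterated absorption. *)
pose P (C : {set T}) := [&& H \subset C, C \subset B, #|C| <= 4 * #|H| &
  2 * #|C| <= #|edge_set G :&: pairs_within C| + 2 * #|H|].
have PH : P H by rewrite /P subxx HB leq_pmull // leq_addl.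
have [C [/and4P[HC CB C4 Ce] Cmax]] : exists C : {set T},
    P C /\ forall D : {set T}, P D -> #|D| <= #|C|.
  by case: (arg_maxnP (fun C : {set T} => #|C|) PH) => C; exists C.
have Clt : #|C| <= (4 * #|H|).-1.
  have [H0|Hpos] := posnP #|H|; first by rewrite H0 in C4 *; lia.
  have [C4E|] := eqVneq #|C| (4 * #|H|); last by lia.
  by have := sparse Hpos C C4E; lia.
exists C; split=> // y; rewrite inE => /andP[yC yB]; rewrite leqNgt;
  apply/negP => y2.
have cyC : #|y |: C| = #|C|.+1 by rewrite cardsU1 yC.
have [H0|Hpos] := posnP #|H|.
  have := subset_leq_card (subsetIr (neighbors G y) C); lia.
suff /Cmax : P (y |: C) by rewrite cyC; lia.
have := edges_within_setU1 yC.
rewrite /P cyC subsetU ?HC ?orbT //= subUset sub1set yB CB /=.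
move=> eU; apply/andP; split; first lia.
apply: leq_trans (leq_add (leq_trans (leq_add (leqnn _) y2) eU) (leqnn _)).
by rewrite addnAC mulnS addnC leq_add2r.
Qed.

(** List counterparts of [back_neighbors], [initial_segment] and [forward_traces]: a list may order
    only some of the vertices, and such partial orders can be concatenated. *)
Definition back_in (s : seq T) (x : T) : {set T} :=
  [set y in s | adj G x y & index y s < index x s].

Definition segment_in (s : seq T) (x : T) : {set T} :=
  [set z in s | index z s <= index x s].

Definition traces_in (s : seq T) (x : T) : {set {set T}} :=
  [set neighbors G y :&: segment_in s x
     | y in [set y in s | adj G x y & index x s < index y s]].

Definition good_order (k : nat) (s : seq T) : Prop :=
  uniq s /\ forall x, x \in s ->
    #|back_in s x| <= k /\ #|[set x] |: traces_in s x| <= k.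

(** An appended vertex adjacent to [x] in [s] has no other neighbour in [C], so at [x] it leaves
    only the trace [[set x]], already counted by [good_order]. For an appended [x], having fewer
    than [k] neighbours in [B] bounds both quantities, and the strict inequality makes room for
    [[set x]]. *)
Lemma good_order_cat (k : nat) (s : seq T) (B C : {set T}) :
  good_order k s -> s =i C -> C \subset B ->
  (forall y, y \in B :\: C ->
     #|neighbors G y :&: C| <= 1 /\ #|neighbors G y :&: B| < k) ->
  good_order k (s ++ enum (B :\: C)) /\ s ++ enum (B :\: C) =i B.
Proof.
move=> [us gs] sC CB BC; set r := enum (B :\: C).
have rE y : (y \in r) = (y \in B :\: C) by rewrite mem_enum.
have srB : s ++ r =i B.
  move=> y; rewrite mem_cat sC rE inE.
  by have := subsetP CB y; case: (y \in C) => //= ->.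
have usr : uniq (s ++ r).
  rewrite cat_uniq us enum_uniq andbT /=; apply/hasPn => y.
  by rewrite rE inE sC => /andP[].
split=> //; split=> // x; rewrite mem_cat => /orP[xs|xr].
- have ix : index x (s ++ r) = index x s by rewrite index_cat xs.
  have lt_s y : y \in s ++ r -> index y (s ++ r) <= index x s -> y \in s.
    rewrite mem_cat index_cat; case: ifP => //= ys yr.
    by rewrite leqNgt ltn_addr ?index_mem.
  have iy y : y \in s -> index y (s ++ r) = index y s by move=> ys;
    rewrite index_cat ys.
  have segE : segment_in (s ++ r) x = segment_in s x.
    apply/setP => y; rewrite !inE ix; apply/andP/andP => -[ys yx].
      have {}ys := lt_s y ys yx; by rewrite -(iy _ ys).
    by rewrite mem_cat ys iy.
  have [backx tracex] := gs x xs; split.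
    apply: leq_trans backx; apply: subset_leq_card; apply/subsetP => y.
    rewrite !inE ix => /and3P[ys xy yx].
    have {}ys := lt_s y ys (ltnW yx); by rewrite ys xy -(iy _ ys).
  apply: leq_trans tracex; apply: subset_leq_card; apply/subsetP => S.
  rewrite !in_setU1 => /orP[->//|/imsetP[y]];
    rewrite inE ix segE => /and3P[ysr xy yx] ->.
  case ys: (y \in s).
    apply/orP; right; apply/imsetP; exists y => //.
    by rewrite inE ys xy -(iy _ ys).
  (* The trace of [y] contains [x] by adjacency and has at most one element. *)
  apply/orP; left; rewrite eq_sym eqEcard cards1 sub1set !inE adjC xy xs leqnn /=.
  have yr : y \in B :\: C by rewrite -rE; move: ysr; rewrite mem_cat ys.
  apply: leq_trans (BC y yr).1; apply: subset_leq_card; apply: setIS.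
  by apply/subsetP => z; rewrite inE -sC => /andP[].
- have xB : x \in B :\: C by rewrite -rE.
  have [_ degx] := BC x xB.
  have sub (A : {set T}) : (forall y, y \in A -> y \in s ++ r /\ adj G x y) ->
    #|A| < k.
    move=> Asr; apply: leq_ltn_trans degx; apply: subset_leq_card;
      apply/subsetP => y.
    by move=> /Asr[]; rewrite srB !inE => -> ->.
  split; first by apply/ltnW/sub => y; rewrite inE => /and3P[].
  rewrite cardsU1; apply: (@leq_trans (1 + #|traces_in (s ++ r) x|)).
    by rewrite leq_add2r leq_b1.
  rewrite add1n; apply: leq_ltn_trans (leq_imset_card _ _) _; apply: sub => y.
  by rewrite inE => /and3P[].
Qed.

(** * The recursion when small sets of vertices span few edges *)

Section SparseGraph.
Variables (a k : nat).
Hypothesis kge : 12 <= k.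
Hypothesis a4T : 4 * a <= #|T|.
Hypothesis sparse : forall (j : nat) (S : {set T}), 0 < j <= 2 * a ->
  #|S| = 2 * j -> #|edge_set G :&: pairs_within S| < 3 * j.

Definition high_degree (B : {set T}) : {set T} :=
  [set v in B | k <= #|neighbors G v :&: B|].

(** Otherwise [4 * #|high_degree B|] is at least [#|B| + 1], and degrees of at least 12 force
    [3 * (#|B| + 1) / 2] edges inside [B], against sparsity. *)
Lemma high_degree_small (B : {set T}) :
  0 < #|B| < 4 * a -> 4 * #|high_degree B| <= #|B|.
Proof.
move=> /andP[B0 Ba]; rewrite leqNgt; apply/negP => Hbig.
have sumH : #|high_degree B| * k <= 2 * #|edge_set G :&: pairs_within B|.
  have HB : high_degree B \subset B by apply/subsetP => v;
    rewrite inE => /andP[].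
  rewrite -sum_nat_const;
    apply: leq_trans (sum_degree_le (A := high_degree B) (B := B) _).
    by apply: leq_sum => v; rewrite inE => /andP[].
  move=> v w /(subsetP HB) vB wB vw; rewrite inE adj_pair //.
  by apply/subsetP => z; rewrite !inE => /orP[]/eqP->.
(* Sparsity concerns even sizes only, so a set of odd size is padded with one vertex; the [+ 1]
   gained above pays for it. *)
have [S [BS [j [j0a jB]]]] : exists S : {set T}, B \subset S /\
    exists j, 0 < j <= 2 * a /\ (#|S| = 2 * j /\ 2 * j <= #|B|.+1).
  have [oB|eB] := boolP (odd #|B|).
    have [x xB] : exists x, x \notin B.
      apply/existsP; rewrite -negb_forall; apply/negP => /forallP BT.
      suff : #|T| <= #|B| by lia.
      by apply: subset_leq_card; apply/subsetP => x _; apply: BT.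
    exists (x |: B); split; first exact: subsetUr.
    exists (#|B|.+1)./2; rewrite cardsU1 xB; lia.
  exists B; split=> //; exists (#|B|)./2; lia.
have := sparse j0a jB.1.
have : #|edge_set G :&: pairs_within B| <= #|edge_set G :&: pairs_within S|.
  apply: subset_leq_card; apply: setIS; apply/subsetP => e; rewrite !inE.
  by move=> /andP[-> eB]; apply: subset_trans BS.
move: jB.2 sumH Hbig kge; nia.
Qed.

(** One step of the recursion, used twice: on the whole vertex set, where [#|H| <= a] brings the
    size below [4 * a], and on small sets, where [4 * #|H| <= #|B|] makes the size drop strictly. *)
Lemma good_order_extend (B H : {set T}) : H \subset B -> #|H| <= a ->
  (forall v, v \in B :\: H -> #|neighbors G v :&: B| < k) ->
  (forall C : {set T}, C \subset B -> #|C| <= (4 * #|H|).-1 ->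
    exists2 s, good_order k s & s =i C) ->
  exists2 s, good_order k s & s =i B.
Proof.
move=> HB Ha low IH.
have [|C [HC CB Csmall C1]] := two_neighbour_closure HB.
  (* With [j = 2 * #|H|], the sizes [2 * j] and [3 * j] are those required by the closure, and
     [#|H| <= a] gives [j <= 2 * a]. *)
  move=> H0 C C4; have := @sparse (2 * #|H|) C; rewrite C4; lia.
have [s gs sC] := IH C CB Csmall.
have [] := good_order_cat gs sC CB _.
  move=> y yBC; split; first exact: C1.
  by apply: low; move: y yBC; apply/subsetP; apply: setDS.
by exists (s ++ enum (B :\: C)).
Qed.

Lemma good_order_small (B : {set T}) : #|B| < 4 * a ->
  exists2 s, good_order k s & s =i B.
Proof.
have [m] := ubnP #|B|; elim: m B => // m IH B Bm Ba.
have [B0|B0] := posnP #|B|.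
  exists [::]; first by split.
  by move=> x; rewrite (cards0_eq B0) inE.
have H4 : 4 * #|high_degree B| <= #|B| by apply: high_degree_small; rewrite B0.
apply: (@good_order_extend B (high_degree B)).
- by apply/subsetP => v; rewrite inE => /andP[].
- lia.
- by move=> v; rewrite !inE => /andP[]; case: (v \in B) => //=; rewrite -ltnNge.
- move=> C CB Csmall; apply: IH; lia.
Qed.

Lemma good_order_exists :
  #|[set v | k <= #|neighbors G v|]| <= a ->
  exists2 s, good_order k s & s =i T.
Proof.
move=> Ha.
suff [s gs sT] : exists2 s, good_order k s & s =i [set: T].
  by exists s => // x; rewrite sT inE.
apply: (good_order_extend (subsetT _) Ha).
  by move=> v; rewrite !inE setIT andbT -ltnNge.
(* For [a = 0] the size of [C] is 0, which is not below [4 * a], so this case is separate. *)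
move=> C _ Csmall; have [a_eq0|apos] := posnP a.
  exists [::]; first by split.
  move=> x; rewrite (_ : C = set0) ?inE //; apply: cards0_eq; lia.
by apply: good_order_small; lia.
Qed.

End SparseGraph.

Lemma good_order_degenerate (R : realType) (k : nat) (x : R) (s : seq T) :
  good_order k s -> s =i T -> (k%:R <= x)%R -> degenerate G x x.
Proof.
move=> [us gs] sT kx.
have szs : size s = #|T| by rewrite cardT -(card_uniqP us) -cardT;
  apply: eq_card.
apply/existsP; exists [ffun i : 'I_#|T| => tnth (tcast szs (in_tuple s)) i].
set v := finfun _.
have iv (i : 'I_#|T|) : index (v i) s = i.
  rewrite ffunE (tnth_nth (enum_val i)) val_tcast /= index_uniq ?szs //.
apply/andP; split.
  by apply/injectiveP => i j ij; apply: val_inj; rewrite /= -iv ij iv.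
apply/forallP => i.
have [backi tracei] := gs (v i) (sT (v i)).
apply/andP; split; apply: le_trans kx; rewrite ler_nat.
  apply: leq_trans backi; apply: subset_leq_card; apply/subsetP => y.
  by case/imsetP => j; rewrite !inE => /andP[ji ij] ->; rewrite sT ij !iv.
apply: leq_trans tracei; apply: subset_leq_card; apply/subsetP => S.
case/imsetP => j; rewrite inE => /andP[ij aij] ->; rewrite in_setU1;
  apply/orP; right.
apply/imsetP; exists (v j); first by rewrite !inE sT aij !iv.
congr (_ :&: _); apply/setP => z; apply/imsetP/idP => [[l]|].
  by rewrite !inE => li ->; rewrite sT !iv.
rewrite !inE => /andP[zs zi];
  have zT : index z s < #|T| by rewrite -szs index_mem.
exists (Ordinal zT); first by rewrite inE -[in X in _ <= X](iv i).
by rewrite ffunE (tnth_nth z) val_tcast /= nth_index.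
Qed.

End Orderings.

(** * Binomial coefficients and numbers of pairs *)

Section BinomialBounds.
Local Open Scope nat_scope.

Lemma bin_le_exp2 (n m : nat) : 'C(n, m) <= 2 ^ n.
Proof.
have := subset_leq_card (subsetT [set A : {set 'I_n} | #|A| == m]).
by rewrite -powersetT card_powerset cardsT card_draws card_ord.
Qed.

Lemma self_exp_le_ffact (m : nat) : m ^ m <= (2 * m) ^_ m.
Proof.
rewrite ffact_prod -[X in m ^ X]card_ord -prod_nat_const.
by apply: leq_prod => i _; have := ltn_ord i; lia.
Qed.

Lemma ffact_le_exp (n m : nat) : n ^_ m <= n ^ m.
Proof.
rewrite ffact_prod -[X in n ^ X]card_ord -prod_nat_const.
by apply: leq_prod => i _; apply: leq_subr.
Qed.

(** An elementary form of the bound by [(e n / m) ^ m], with 4 in place of Euler's number: [m ^ m]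
    is at most [(2 * m) ^_ m], that is ['C(2 * m, m) * m]![, hence at most]4 ^ m * m[!]. *)
Lemma bin_mul_self_exp_le (n m : nat) : 'C(n, m) * m ^ m <= (4 * n) ^ m.
Proof.
apply: (@leq_trans ('C(n, m) * (4 ^ m * m`!))).
  rewrite leq_mul2l; apply/orP; right.
  apply: leq_trans (self_exp_le_ffact m) _; rewrite -bin_ffact leq_mul2r.
  by apply/orP; right; have := bin_le_exp2 (2 * m) m; rewrite expnM.
by rewrite mulnCA bin_ffact expnMn leq_mul2l ffact_le_exp orbT.
Qed.

Lemma card_pairs_meeting (T : finType) (S : {set T}) :
  #|pairs_meeting S| <= #|S| * #|T|.
Proof.
rewrite -cardsT -cardsX; apply: leq_trans (leq_imset_card (fun x => [set x.1;
  x.2]) _).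
apply: subset_leq_card; apply/subsetP => e.
rewrite inE in_vertex_pairs => /andP[/cards2P[x [y [_ ->]]] /set0Pn[z]].
rewrite !inE => /andP[/orP[]/eqP-> zS]; apply/imsetP.
  by exists (x, y) => //; rewrite !inE /= zS.
by exists (y, x); [rewrite !inE /= zS | rewrite setUC].
Qed.

Lemma card_pairs_within (T : finType) (S : {set T}) :
  #|pairs_within S| = 'C(#|S|, 2).
Proof.
rewrite -cards_draws; apply: eq_card => e.
by rewrite [LHS]inE [RHS]inE andbC in_vertex_pairs.
Qed.

Lemma exists_subset_card (T : finType) (X : {set T}) (m : nat) : m <= #|X| ->
  exists2 Y : {set T}, Y \subset X & #|Y| = m.
Proof.
rewrite -bin_gt0 -cards_draws card_gt0 => /set0Pn[Y].
by rewrite inE => /andP[YX /eqP]; exists Y.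
Qed.

End BinomialBounds.

(** * Probabilities in the random graph and union bounds *)

Section GnpProbability.
Variables (R : realType) (n : nat) (p : R).
Implicit Types (A B : pred (sgraph 'I_n)) (F : {set {set 'I_n}}).

(** Expand the product of the sums [f e + g e], where [f] is the weight of a present pair and [g]
    that of an absent one. Terms that are not graphs, or that miss an element of [F], contain a
    factor 0; each sum is [p] on [F] and 1 elsewhere. An empty [F] gives total mass 1. *)
Lemma Gnp_prob_superset F : F \subset vertex_pairs 'I_n ->
  Gnp_prob p (fun G : sgraph 'I_n => F \subset edge_set G) = p ^+ #|F|.
Proof.
move=> Fpairs; pose V := vertex_pairs 'I_n.
pose w (E : {set {set 'I_n}}) : R := \prod_(e in V) (if e \in E then p
  else 1 - p).
rewrite /Gnp_prob -(big_sub_cond [pred E : {set {set 'I_n}} | E \subset V]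
  [pred E : {set {set 'I_n}} | F \subset E] w).
pose f (e : {set 'I_n}) : R := if e \in V then p else 0.
pose g (e : {set 'I_n}) : R := if e \in V then (if e \in F then 0
  else 1 - p) else 1.
transitivity (\prod_e (f e + g e)); last first.
  rewrite -prodr_const [RHS]big_mkcond /=; apply: eq_bigr => e _; rewrite /f /g.
  have := subsetP Fpairs e; rewrite -/V.
  case: (e \in V); case: (e \in F) => // H; first by rewrite addr0.
  - by rewrite addrC subrK.
  - by have := H isT.
  - by rewrite add0r.
rewrite bigA_distr [LHS]big_mkcond; apply: eq_bigr => E _ /=.
case: ifPn => [/andP[EV FE]|].
  rewrite /w big_mkcond; apply: eq_bigr => e _ /=; rewrite /f /g.
  have := subsetP EV e; have := subsetP FE e.
  case: (e \in V); case: (e \in E); case: (e \in F) => // H1 H2;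
    by [have := H1 isT | have := H2 isT].
rewrite inE negb_and => /orP[] /subsetPn[e e1 e2]; rewrite (bigD1 e) //=.
  by rewrite e1 /f (negPf e2) mul0r.
by rewrite (negPf e2) /g e1 (subsetP Fpairs) // mul0r.
Qed.

Lemma Gnp_prob_predC A : Gnp_prob p A = 1 - Gnp_prob p (predC A).
Proof.
have := Gnp_prob_superset (sub0set _); rewrite cards0 expr0 => <-.
apply/eqP; rewrite eq_sym subr_eq; apply/eqP; rewrite /Gnp_prob (bigID A) /=.
by congr (_ + _); apply: eq_bigl => G; rewrite sub0set.
Qed.

Hypothesis p01 : 0 <= p <= 1.

Lemma Gnp_weight_ge0 (G : sgraph 'I_n) :
  0 <= \prod_(e in vertex_pairs 'I_n) (if e \in edge_set G then p else 1 - p).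
Proof.
by apply: prodr_ge0 => e _; case: ifP; rewrite ?subr_ge0; case/andP: p01.
Qed.

Lemma Gnp_prob_ge0 A : 0 <= Gnp_prob p A.
Proof. by apply: sumr_ge0 => G _; apply: Gnp_weight_ge0. Qed.

Lemma Gnp_prob_union (I : finType) (P : pred I) A (B : I ->
  pred (sgraph 'I_n)) :
  (forall G, A G -> exists2 i, P i & B i G) ->
  Gnp_prob p A <= \sum_(i | P i) Gnp_prob p (B i).
Proof.
move=> AB; rewrite /Gnp_prob (exchange_big_dep xpredT) //= big_mkcond /=.
apply: ler_sum => G _; have w0 := Gnp_weight_ge0 G.
case: ifPn => [/AB[i Pi Bi]|_]; last by apply: sumr_ge0.
by rewrite (bigD1 i) ?Pi //= lerDl sumr_ge0.
Qed.

(** Two union bounds, over the sets [S] and then over the [m]-element subsets of [Z S], each of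
    which is present with probability [p ^+ m]. *)
Lemma Gnp_prob_dense (Z : {set 'I_n} -> {set {set 'I_n}}) (a N m : nat) :
  (forall S, Z S \subset vertex_pairs 'I_n) ->
  (forall S : {set 'I_n}, #|S| = a -> (#|Z S| <= N)%N) ->
  Gnp_prob p (fun G : sgraph 'I_n =>
    [exists S : {set 'I_n}, (#|S| == a) && (m <= #|edge_set G :&: Z S|)%N])
  <= 'C(n, a)%:R * ('C(N, m)%:R * p ^+ m).
Proof.
move=> ZV ZN; have /andP[p0 _] := p01.
apply: (@le_trans _ _ (\sum_(S : {set 'I_n} | #|S| == a) Gnp_prob p (fun G : sgraph 'I_n =>
    (m <= #|edge_set G :&: Z S|)%N))).
  by apply: Gnp_prob_union => G /existsP[S /andP[Sa mS]]; exists S.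
have -> : 'C(n, a) = #|[set S : {set 'I_n} | #|S| == a]| by rewrite card_draws card_ord.
rewrite mulr_natl -sumr_const.
rewrite [leRHS](eq_bigl (fun S : {set 'I_n} => #|S| == a)); last by move=> S;
  rewrite inE.
apply: ler_sum => S /eqP Sa.
apply: (@le_trans _ _ (\sum_(F : {set {set 'I_n}} | (F \subset Z S) && (#|F| == m))
    Gnp_prob p (fun G : sgraph 'I_n => F \subset edge_set G))).
  apply: Gnp_prob_union => G /exists_subset_card[F];
    rewrite subsetI => /andP[FG FZ] Fm.
  by exists F; rewrite // FZ Fm eqxx.
rewrite (eq_bigr (fun=> p ^+ m)); last first.
  by move=> F /andP[FZ /eqP<-]; apply: Gnp_prob_superset;
    apply: subset_trans FZ (ZV S).
rewrite sumr_const -[leLHS]mulr_natl ler_wpM2r ?exprn_ge0 // ler_nat.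
apply: leq_trans (leq_bin2l m (ZN S Sa)); rewrite -cards_draws.
by apply: subset_leq_card; apply/subsetP => F; rewrite inE.
Qed.

End GnpProbability.

(** * Numerical estimates of the union bounds *)

Section RealBounds.
Variable R : realType.

Lemma ler_exprl (m : nat) (x y : R) : 0 <= x -> x <= y -> x ^+ m <= y ^+ m.
Proof. by move=> x0 xy; apply: lerXn2r; rewrite ?nnegrE // (le_trans x0). Qed.

Lemma binR_le (n m : nat) : (0 < m)%N ->
  'C(n, m)%:R <= (4 * n%:R / m%:R) ^+ m :> R.
Proof.
move=> m0; have mR : 0 < m%:R :> R by rewrite ltr0n.
rewrite expr_div_n ler_pdivlMr ?exprn_gt0 // -!natrX -!natrM -natrX ler_nat.
exact: bin_mul_self_exp_le.
Qed.

Lemma sum_succ_half_pow_le (N : nat) :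
  \sum_(j < N) (j.+1%:R * 2^-1 ^+ j) <= 4 :> R.
Proof.
suff -> : \sum_(j < N)
  (j.+1%:R * 2^-1 ^+ j) = 4 - 2 * (N%:R + 2) * 2^-1 ^+ N :> R.
  by rewrite gerBl !mulr_ge0 ?exprn_ge0 ?addr_ge0 ?invr_ge0.
elim: N => [|N IH]; first by rewrite big_ord0 expr0; field.
by rewrite big_ord_recr /= IH exprS -[N.+1]addn1 natrD; field.
Qed.

(** Write [K] for [108 * (D + 1) ^ 3]. As [j + 1 <= 2 * a], the base [K * (j + 1) / n] is at most
    1/2. One factor is kept, for the decay in [n], and the other [j] are bounded by 1/2. *)
Lemma sum_dense_terms_le (n D a : nat) : (0 < n)%N ->
  (4 * (108 * (D + 1) ^ 3) * a <= n)%N ->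
  \sum_(j < 2 * a) (108 * (D%:R + 1) ^+ 3 * j.+1%:R / n%:R) ^+ j.+1
    <= 4 * (108 * (D%:R + 1) ^+ 3) / n%:R :> R.
Proof.
move=> n0; have nR : 0 < n%:R :> R by rewrite ltr0n.
pose K : R := 108 * (D%:R + 1) ^+ 3.
have K0 : 0 <= K by rewrite mulr_ge0 ?exprn_ge0 ?addr_ge0.
have KE : K = (108 * (D + 1) ^ 3)%:R by rewrite natrM natrX natrD.
move=> Kan; rewrite -/K -mulrA [4 * _]mulrC.
apply: (@le_trans _ _ (K / n%:R * \sum_(j < 2 * a) (j.+1%:R * 2^-1 ^+ j)));
  last first.
  by rewrite ler_wpM2l ?divr_ge0 // sum_succ_half_pow_le.
rewrite mulr_sumr; apply: ler_sum => j _.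
rewrite exprS mulrA [K / _ * _]mulrAC ler_wpM2l ?divr_ge0 ?mulr_ge0 //.
apply: ler_exprl; first by rewrite divr_ge0 ?mulr_ge0.
rewrite ler_pdivrMr //.
rewrite KE -[X in _ <= X]mulrC ler_pdivlMr // -!natrM ler_nat.
have := ltn_ord j; set k := (108 * _)%N in Kan *; nia.
Qed.

Variables (n D : nat) (p : R).
Hypotheses (D10 : (10 <= D)%N) (n0 : (0 < n)%N) (p0 : 0 <= p).
Hypothesis npD : n%:R * p <= D%:R + 1.

(** The edge factor has base at most [n * p / (2 * D)], hence at most 11/20 because [D] is at least
    10. Since [32 * (11 / 20) ^ 8 <= 1 / 2], eight edges per unit of [D] outweigh the [32 ^ D]
    coming from the choice of the set, leaving at most [4 / 2 ^ 10] per vertex. *)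
Lemma high_degree_term_le (a : nat) : (0 < a)%N -> (n <= 32 ^ D * a)%N ->
  'C(n, a)%:R * ('C(a * n, 8 * D * a)%:R * p ^+ (8 * D * a)) <= 2^-1 ^+ a.
Proof.
move=> a0 nMa; have aR : 0 < a%:R :> R by rewrite ltr0n.
have D10R : 10 <= D%:R :> R by rewrite ler_nat.
have DR : 0 < D%:R :> R by lra.
have B1 : 'C(n, a)%:R <= (4 * 32 ^+ D) ^+ a :> R.
  apply: le_trans (binR_le n a0) _; apply: ler_exprl;
    first by rewrite divr_ge0 ?mulr_ge0.
  by rewrite -mulrA ler_pM2l // ler_pdivrMr // -natrX -natrM ler_nat.
have B2 : 'C(a * n, 8 * D * a)%:R * p ^+ (8 * D * a)
  <= (((11 / 20) ^+ 8) ^+ D) ^+ a :> R.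
  have m0 : (0 < 8 * D * a)%N by rewrite !muln_gt0 a0 andbT; lia.
  rewrite -!exprM mulnA;
    apply: (@le_trans _ _ ((4 * (a * n)%:R / (8 * D * a)%:R * p) ^+ (8 * D * a))).
    by rewrite exprMn ler_wpM2r ?exprn_ge0 // binR_le.
  apply: ler_exprl; first by rewrite mulr_ge0 ?divr_ge0 ?mulr_ge0.
  have -> : 4 * (a * n)%:R / (8 * D * a)%:R * p = n%:R * p / (2 * D%:R) :> R.
    rewrite !natrM; field; rewrite !gt_eqF //.
  rewrite ler_pdivrMr ?mulr_gt0 //; apply: le_trans npD _; lra.
apply: (le_trans (ler_pM _ _ B1 B2)) => //;
  first by rewrite mulr_ge0 ?exprn_ge0.
rewrite -exprMn; apply: ler_exprl.
  by do ![apply: mulr_ge0 | apply: exprn_ge0 | apply: divr_ge0].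
rewrite -mulrA -exprMn.
have q2 : 32 * (11 / 20) ^+ 8 <= 2^-1 :> R by lra.
apply: (@le_trans _ _ (4 * 2^-1 ^+ 10)); last by lra.
rewrite ler_pM2l //; apply: (@le_trans _ _ (2^-1 ^+ D)).
  by apply: ler_exprl => //; rewrite mulr_ge0 ?exprn_ge0 ?divr_ge0.
by apply: ler_wiXn2l => //; lra.
Qed.

Lemma dense_term_le (s : nat) : (0 < s)%N ->
  'C(n, 2 * s)%:R * ('C(2 * (s * s), 3 * s)%:R * p ^+ (3 * s))
    <= (108 * (D%:R + 1) ^+ 3 * s%:R / n%:R) ^+ s.
Proof.
move=> s0; have sR : 0 < s%:R :> R by rewrite ltr0n.
have nR : 0 < n%:R :> R by rewrite ltr0n.
have B1 : 'C(n, 2 * s)%:R <= ((2 * n%:R / s%:R) ^+ 2) ^+ s :> R.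
  rewrite -exprM; apply: le_trans (@binR_le n (2 * s) _) _;
    first by rewrite muln_gt0.
  by rewrite natrM (_ : 4 * n%:R / _ = 2 * n%:R / s%:R) //; field;
    rewrite !gt_eqF //.
have B2 : 'C(2 * (s * s), 3 * s)%:R * p ^+ (3 * s)
  <= ((3 * s%:R * p) ^+ 3) ^+ s :> R.
  rewrite -exprM exprMn ler_wpM2r ?exprn_ge0 //.
  apply: le_trans (@binR_le _ (3 * s) _) _; first by rewrite muln_gt0.
  apply: ler_exprl; first by rewrite divr_ge0 ?mulr_ge0.
  (* The constant 8/3 is rounded up to 3, which yields [108 = 2 ^ 2 * 3 ^ 3] below. *)
  have -> : 4 * (2 * (s * s))%:R / (3 * s)%:R = (8 / 3) * s%:R :> R.
    rewrite !natrM; field; rewrite !gt_eqF //.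
  by lra.
apply: (le_trans (ler_pM _ _ B1 B2)) => //;
  first by rewrite mulr_ge0 ?exprn_ge0.
have np0 : 0 <= n%:R * p by rewrite mulr_ge0.
rewrite -exprMn; apply: ler_exprl.
  by do ![apply: mulr_ge0 | apply: exprn_ge0 | apply: divr_ge0].
have -> : (2 * n%:R / s%:R) ^+ 2 * (3 * s%:R * p) ^+ 3
    = 108 * (n%:R * p) ^+ 3 * s%:R / n%:R :> R by field; rewrite !gt_eqF //.
rewrite ler_pM2r ?invr_gt0 // ler_pM2r // ler_pM2l //.
exact: ler_exprl.
Qed.

End RealBounds.

(** * Combining the estimates *)

Lemma pow32_ge (D : nat) : (10 <= D)%N -> (8 * (108 * (D + 1) ^ 3) <= 32 ^ D)%N.
Proof.
(* The factor [(2 ^ D) ^ 3] dominates [(D + 1) ^ 3], and [4 ^ D] is at least [4 ^ 10], which exceeds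
   [8 * 108]. *)
move=> D10; have -> : (32 ^ D = 4 ^ D * (2 ^ D) ^ 3)%N.
  by rewrite -[32%N]/(4 * 2 ^ 3)%N expnMn -!expnM [(3 * D)%N]mulnC.
have D2 : ((D + 1) ^ 3 <= (2 ^ D) ^ 3)%N by rewrite leq_exp2r // addn1 ltn_expl.
rewrite mulnA; apply: leq_mul => //.
by apply: leq_trans (leq_pexp2l (n1 := 10) _ D10).
Qed.

(* The 16 D a half-edges at a vertices of degree at least 16 D come from at
   least 8 D a edges. *)
Lemma high_degree_dense (T : finType) (G : sgraph T) (D a : nat) :
  (a < #|[set v | 16 * D <= #|neighbors G v|]|)%N ->
  exists S : {set T}, (#|S| == a) && (8 * D * a
    <= #|edge_set G :&: pairs_meeting S|)%N.
Proof.
move=> /ltnW/exists_subset_card[S SH Sa]; exists S; rewrite Sa eqxx /=.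
suff : (#|S| * (16 * D) <= 2 * #|edge_set G :&: pairs_meeting S|)%N.
  have -> : (#|S| * (16 * D) = 2 * (8 * D * a))%N by rewrite Sa; nia.
  by rewrite leq_pmul2l.
rewrite -sum_nat_const.
apply: leq_trans (sum_degree_le (G := G) (A := S) (B := [set: T]) _).
  by apply: leq_sum => v /(subsetP SH); rewrite inE setIT.
move=> v w vS _ vw; rewrite inE (adj_pair vw); apply/set0Pn; exists v.
by rewrite !inE eqxx.
Qed.

Lemma Gnp_not_degenerate_le (R : realType) (d : R) (D n : nat) :
  (10 <= D)%N -> D%:R <= d <= D%:R + 1 -> (32 ^ D <= n)%N ->
  Gnp_prob (d / n%:R) (predC (fun G : sgraph 'I_n => degenerate G (16 * d)
    (16 * d)))
    <= (32 ^+ D + 4 * (108 * (D%:R + 1) ^+ 3)) / n%:R.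
Proof.
move=> D10 /andP[Dd dD] nM; set p := d / n%:R.
(* The successor makes [a] positive with [n <= 32 ^ D * a], while [a * 32 ^ D] stays below
   [2 * n]. *)
pose a := (n %/ 32 ^ D).+1.
have K8 := pow32_ge D10.
have M0 : (0 < 32 ^ D)%N by rewrite expn_gt0.
have M8 : (8 <= 32 ^ D)%N.
  by apply: leq_trans K8; rewrite leq_pmulr // muln_gt0 expn_gt0 addn1.
have Dn : (D + 1 <= n)%N by rewrite addn1 (leq_trans _ nM) // ltn_expl.
have n0 : (0 < n)%N by lia.
have nR : 0 < n%:R :> R by rewrite ltr0n.
have nMa : (n <= 32 ^ D * a)%N by rewrite mulnC ltnW // ltn_ceil.
have aM : (a * 32 ^ D <= 2 * n)%N.
  by rewrite /a mulSn mul2n -addnn leq_add // leq_divM.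
have p0 : 0 <= p by rewrite divr_ge0 // (le_trans _ Dd).
have p01 : 0 <= p <= 1.
  by rewrite p0 ler_pdivrMr // mul1r (le_trans dD) // natr1 ler_nat -addn1.
have npD : n%:R * p <= D%:R + 1 by rewrite /p mulrC divfK ?gt_eqF.
have a4n : (4 * a <= n)%N by nia.
have Kan : (4 * (108 * (D + 1) ^ 3) * a <= n)%N.
  by move: K8; set K := (108 * _)%N => K8; nia.
pose high (G : sgraph 'I_n) := [exists S : {set 'I_n},
  (#|S| == a) && (8 * D * a <= #|edge_set G :&: pairs_meeting S|)%N].
pose dense (j : nat) (G : sgraph 'I_n) := [exists S : {set 'I_n},
  (#|S| == 2 * j)%N && (3 * j <= #|edge_set G :&: pairs_within S|)%N].
(* One index for each bad event: [None] for many high degrees, [Some j] for a dense set of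
   [2 * (j + 1)] vertices. *)
pose bad (i : option 'I_(2 * a)) := if i is Some j then dense j.+1 else high.
apply: (le_trans (@Gnp_prob_union R n p p01 _ xpredT _ bad _)).
  move=> G /=; apply: contraNP => nobad.
  have sparse (j : nat) (S : {set 'I_n}) : (0 < j <= 2 * a)%N ->
    (#|S| = 2 * j)%N ->
      (#|edge_set G :&: pairs_within S| < 3 * j)%N.
    case: j => // j /= ja Sj; rewrite ltnNge; apply/negP => Sdense;
      apply: nobad.
    by exists (Some (Ordinal ja)) => //; apply/existsP; exists S;
      rewrite Sj eqxx.
  have few : (#|[set v | 16 * D <= #|neighbors G v|]| <= a)%N.
    rewrite leqNgt; apply/negP => /high_degree_dense[S Sa]; apply: nobad.
    by exists None => //; apply/existsP; exists S.
  have [||s gs sT] := good_order_exists (G := G) _ _ sparse few.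
  - lia.
  - by rewrite card_ord.
  apply: (good_order_degenerate gs sT).
  by rewrite natrM ler_pM2l.
rewrite (bigD1 None) //= mulrDl; apply: lerD.
  apply: (@le_trans _ _ ('C(n, a)%:R * ('C(a * n, 8 * D * a)%:R * p ^+ (8 * D * a)))).
    apply: Gnp_prob_dense => // S.
      by apply/subsetP => e; rewrite inE => /andP[].
    by move=> <-; rewrite -[X in (_ <= _ * X)%N](card_ord n) card_pairs_meeting.
  apply: (le_trans (high_degree_term_le D10 n0 p0 npD _ nMa)) => //.
  (* [2 ^- a] is at most [32 ^ D / n], because [n <= 32 ^ D * a] and [a <= 2 ^ a]. *)
  rewrite ler_pdivlMr // exprVn mulrC ler_pdivrMr ?exprn_gt0 // -!natrX -natrM ler_nat.
  by apply: leq_trans nMa _; apply: leq_mul => //; apply/ltnW/ltn_expl.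
rewrite (reindex_omap Some id) => [|[]//] /=.
rewrite (eq_bigl xpredT) => [|j]; last exact: eqxx.
apply: (le_trans _ (sum_dense_terms_le R n0 Kan)); apply: ler_sum => j _.
apply: (le_trans _ (dense_term_le n0 p0 npD _)) => //.
apply: Gnp_prob_dense => // S.
  by apply/subsetP => e; rewrite inE => /andP[].
move=> Sj; rewrite card_pairs_within Sj bin2; lia.
Qed.

(* For n < d the number d / n is not a probability; this concerns only
   finitely many n and does not affect the limit. *)
Theorem theorem4p8 (R : realType) (d : R) (hd : 10 <= d) :
  almost_surely (fun n : nat => d / n%:R)
    (fun (n : nat) (G : sgraph 'I_n) => degenerate G (16 * d) (16 * d)).
Proof.
have d0 : 0 <= d by lra.
pose D := Num.truncn d.
have /andP[Dd dD] : D%:R <= d < D.+1%:R by rewrite truncn_itv.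
have D10 : (10 <= D)%N by rewrite -ltnS -(ltr_nat R) (le_lt_trans hd).
pose C : R := 32 ^+ D + 4 * (108 * (D%:R + 1) ^+ 3).
have C0 : 0 <= C by rewrite addr_ge0 ?mulr_ge0 ?exprn_ge0 ?addr_ge0.
(* [harmonic n] is [1 / (n + 1)]; the factor 2 absorbs the shift, as [n + 1 <= 2 * n]. *)
apply: (@squeeze_cvgr _ _ _ _ (fun n => 1 - 2 * C * harmonic n) (fun=> 1)).
- near=> n; have nM : (32 ^ D <= n)%N by near: n; apply: nbhs_infty_ge.
  have n0 : (0 < n)%N by rewrite (leq_trans _ nM) // expn_gt0.
  have nR : 1 <= n%:R :> R by rewrite ler1n.
  have dn : d <= n%:R.
    by rewrite (le_trans (ltW dD)) // ler_nat (leq_trans _ nM) // ltn_expl.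
  have p01 : 0 <= d / n%:R <= 1.
    by rewrite divr_ge0 // ler_pdivrMr ?mul1r //; lra.
  rewrite Gnp_prob_predC gerBl Gnp_prob_ge0 // andbT lerD2l lerN2.
  have dD1 : D%:R <= d <= D%:R + 1 by rewrite Dd natr1 ltW.
  apply: (le_trans (Gnp_not_degenerate_le D10 dD1 nM)); rewrite -/C.
  rewrite /= [2 * C]mulrC -!mulrA ler_wpM2l // ler_pdivlMr ?ltr0n //.
  by rewrite -natr1 mulrC ler_pdivrMr; lra.
- have : ((fun n =>
    1 - 2 * C * harmonic n) @ \oo --> (1 - 2 * C * 0 : R))%classic.
    apply: cvgB; first exact: cvg_cst.
    by apply: cvgM; [exact: cvg_cst | exact: cvg_harmonic].
  by rewrite mulr0 subr0.
- exact: cvg_cst.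
Unshelve. all: by end_near.
Qed.
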